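(* Let $d\geq 3$, $N\geq 1$, and let $\bar{X}\in\left(\mathbb{R}^{d}\right)^N$ be generic. Then there exists a neighborhood $\mathcal{U}$ of $\bar{X}$ such that every $X\in\mathcal{U}$ is generic and the generalized cap discrepancy $\Lambda$ is Lipschitz continuous on $\mathcal{U}$, i.e., there is $L>0$ with $|\Lambda(X_1)-\Lambda(X_2)|\leq L\|X_1-X_2\|$ for all $X_1,X_2\in\mathcal{U}$.
   Context: Standing assumption: $d\geq 3$. Points sets $X=(x^{(1)},\ldots,x^{(N)})\in(\mathbb{R}^d)^N$ are identified with $(d,N)$ matrices; $\|\cdot\|$ is the Euclidean norm. $X$ is generic if for every $I\subseteq\{1,\ldots,N\}$ with $\#I\leq d$ the vectors $\{x^{(i)}\mid i\in I\}$ are linearly independent. Let $\Phi=\{I\subseteq\{1,\ldots,N\}\mid 1\leq\#I\leq d\}$. For generic $X$ and $I\in\Phi$, let $X_I$ be the matrix with columns $x^{(i)}$, $i\in I$ (in increasing order of $i$), $\mathbf{1}=(1,\ldots,1)^\top\in\mathbb{R}^{\#I}$, and $t_I(X)=\left(\mathbf{1}^\top(X_I^\top X_I)^{-1}\mathbf{1}\right)^{-1/2}$, $w_I(X)=t_I(X)X_I(X_I^\top X_I)^{-1}\mathbf{1}$. Let $C_d=1/\int_0^\pi\sin^{d-2}(\tau)d\tau$ and $\mu^{cap}(t)=C_d\int_0^{\arccos t}\sin^{d-2}(\tau)d\tau$ for $0\leq t\leq 1$, $\mu^{cap}(t)=1-C_d\int_0^{\arccos(-t)}\sin^{d-2}(\tau)d\tau$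 for $-1\leq t<0$ (this is the normalized surface measure of a spherical cap $\{x\in\mathbb{S}^{d-1}\mid\langle w,x\rangle\geq t\}$, $w\in\mathbb{S}^{d-1}$). Define $\mu^{Cap}:\mathbb{R}\to\mathbb{R}$ by $\mu^{Cap}(t)=\mu^{cap}(t)$ for $t\in[-1,1]$; for $|t|>1$: $\mu^{Cap}(t)=-t/2+1/2$ if $d=3$, and $\mu^{Cap}(t)=0$ for $t>1$, $\mu^{Cap}(t)=1$ for $t<-1$ if $d\geq 4$. For $X\in(\mathbb{R}^d)^N$, $(w,t)\in\mathbb{R}^{d+1}$, put $\mu^{Emp}(X,w,t)=N^{-1}\#\{i\mid\langle w,x^{(i)}\rangle\geq t\}$. For generic $X$, the generalized cap discrepancy is \[\Lambda(X)=\max_{I\in\Phi}\max\{\mu^{Emp}(X,w_I(X),t_I(X))-\mu^{Cap}(t_I(X)),\ \mu^{Emp}(X,-w_I(X),-t_I(X))-\mu^{Cap}(-t_I(X))\}.\] *)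

(* Defs.v *)
From HB Require Import structures.
From mathcomp Require Import all_boot all_order all_algebra.
From mathcomp Require Import all_classical all_reals all_analysis.

Set Implicit Arguments.
Unset Strict Implicit.
Unset Printing Implicit Defensive.

Import Order.TTheory GRing.Theory Num.Theory.
Import numFieldNormedType.Exports.

Local Open Scope ring_scope.

(* A point set in (R^d)^N is a d x N matrix whose columns are the points. *)

Section CapDiscrepancy.
Variable R : realType.

(* The library norm `|X| on matrices is the sup norm. *)
Definition euclidean_norm (d N : nat) (X : 'M[R]_(d, N)) : R :=
  Num.sqrt (\sum_i \sum_j X i j ^+ 2).

Definition dotp (d : nat) (u v : 'cV[R]_d) : R := (u^T *m v) ord0 ord0.

Section PointSets.
Variables d N : nat.
Implicit Types (X : 'M[R]_(d, N)) (I : {set 'I_N}).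

Definition generic X : Prop :=
  forall I, (#|I| <= d)%N -> free [seq col i X | i <- enum I].

Definition Phi : {pred {set 'I_N}} := [pred I : {set 'I_N} | (1 <= #|I| <= d)%N].

(* enum_val lists the elements of I in increasing order. *)
Definition subcols X I : 'M[R]_(d, #|I|) :=
  colsub (fun k : 'I_#|I| => enum_val k) X.

Definition ones (n : nat) : 'cV[R]_n := const_mx 1.

Definition gram X I : 'M[R]_#|I| := (subcols X I)^T *m subcols X I.

Definition tI X I : R :=
  (Num.sqrt (((ones #|I|)^T *m invmx (gram X I) *m ones #|I|) ord0 ord0))^-1.

Definition wI X I : 'cV[R]_d :=
  tI X I *: (subcols X I *m invmx (gram X I) *m ones #|I|).

Definition mu_emp X (w : 'cV[R]_d) (t : R) : R :=
  #|[pred i : 'I_N | t <= dotp w (col i X)]|%:R / N%:R.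

End PointSets.

Arguments Phi : clear implicits.

Definition sin_integral (d : nat) (a : R) : R :=
  \int[lebesgue_measure]_(tau in `[0, a]%classic) (sin tau ^+ (d - 2)).

Definition Cd (d : nat) : R := (sin_integral d pi)^-1.

(* Meaningful for -1 <= t <= 1 only. *)
Definition mu_cap (d : nat) (t : R) : R :=
  if 0 <= t then Cd d * sin_integral d (acos t)
  else 1 - Cd d * sin_integral d (acos (- t)).

(* Meaningful for d >= 3 only. *)
Definition mu_Cap (d : nat) (t : R) : R :=
  if -1 <= t <= 1 then mu_cap d t
  else if d == 3%N then - t / 2 + 1 / 2
  else if 1 < t then 0 else 1.

Definition local_discrepancy (d N : nat) (X : 'M[R]_(d, N)) (I : {set 'I_N}) : R :=
  Num.max (mu_emp X (wI X I) (tI X I) - mu_Cap d (tI X I))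
          (mu_emp X (- wI X I) (- tI X I) - mu_Cap d (- tI X I)).

(* The supremum is over a finite set, nonempty when d, N >= 1; it is then the
   maximum, see Lambda_max. *)
Definition Lambda (d N : nat) (X : 'M[R]_(d, N)) : R :=
  sup [set local_discrepancy X I | I in [set J : {set 'I_N} | J \in Phi d N]]%classic.

Lemma Lambda_max (d N : nat) (X : 'M[R]_(d, N)) : (0 < d)%N -> (0 < N)%N ->
  (exists2 I : {set 'I_N}, I \in Phi d N & Lambda X = local_discrepancy X I) /\
  (forall I : {set 'I_N}, I \in Phi d N -> local_discrepancy X I <= Lambda X).
Proof.
move=> d0 N0.
have I0P : [set Ordinal N0]%SET \in Phi d N by rewrite inE cards1.
case: (arg_maxP (local_discrepancy X) I0P) => J JP Jmax.
suff -> : Lambda X = local_discrepancy X J by split; [exists J|].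
apply/eqP; rewrite eq_le; apply/andP; split.
  apply: ge_sup; first by exists (local_discrepancy X J), J.
  by move=> _ [I IP <-]; exact: Jmax.
apply: ub_le_sup; last by exists J.
by exists (local_discrepancy X J) => _ [I IP <-]; exact: Jmax.
Qed.

End CapDiscrepancy.

(* Main.v *)
Require Import Defs.
From HB Require Import structures.
From mathcomp Require Import all_boot all_order all_algebra.
From mathcomp Require Import all_classical all_reals all_analysis.
From mathcomp Require Import ring lra.
Import Order.TTheory GRing.Theory Num.Theory.
Import numFieldNormedType.Exports.
Local Open Scope ring_scope.

(* Every generic X satisfies
     Lambda X = max over nonempty index sets A of #|A| / N - mu_Cap (F_A X),
   where F_A X is the maximum over unit vectors w of the minimum of <w, x_i> over
   i in A.  Indeed a maximiser w, with value t = F_A X, is (wI, tI) or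
   (- wI, - tI) for some I in Phi; the second kind occurs exactly when 0 is
   interior to the convex hull of A, and t = 0 is excluded by genericity.  As
   F_A is Lipschitz in X, and mu_Cap is nonincreasing and Lipschitz, Lambda is
   Lipschitz on the whole set of generic X, which is open because it is defined
   by the nonvanishing of Gram determinants. *)

(** * Monotonicity and Lipschitz continuity of [mu_Cap] *)

Section CapMeasure.
Variable R : realType.
Implicit Types (d : nat) (a b t x : R).

Lemma is_derive_MVT (f df : R -> R) a b : a < b ->
    (forall x, a <= x <= b -> is_derive x 1 f (df x)) ->
  exists2 c, a < c < b & f b - f a = df c * (b - a).
Proof.
move=> ab dfP; have [||c] := @MVT _ f df a b ab.
- by move=> x /[!in_itv] /andP[/ltW ax /ltW xb]; apply: dfP; rewrite ax.
- apply: continuous_in_subspaceT => x /set_mem /=; rewrite in_itv /= => /dfP fx.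
  exact/differentiable_continuous/derivable1_diffP.
- by rewrite in_itv /=; exists c.
Qed.

(* The base point -1 makes the primitive differentiable at the endpoint 0. *)
Lemma sin_integral_primitive d : exists G : R -> R,
  (forall x, 0 <= x <= pi -> is_derive x 1 G (sin x ^+ (d - 2))) /\
  (forall x, 0 <= x -> sin_integral d x = G x - G 0).
Proof.
pose f (x : R) := sin x ^+ (d - 2).
have cf : continuous f.
  move=> x; apply: (@continuous_comp _ _ _ sin (fun y : R => y ^+ (d - 2))).
    exact: continuous_sin.
  exact: exprn_continuous.
have If a b : lebesgue_measure.-integrable `[a, b] (EFin \o f).
  apply: continuous_compact_integrable; first exact: segment_compact.
  exact: continuous_subspaceT.
exists (fun x => \int[lebesgue_measure]_(t in `[(-1)%R, x]) f t); split.
- move=> x /andP[x0 _].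
  have [|||dG GE] := @continuous_FTC1_closed _ f (-1) x (x + 1) _ (If _ _).
  + by rewrite ltrDl.
  + by lra.
  + exact: cf.
  + by apply: DeriveDef dG _; rewrite -derive1E; exact: GE.
- move=> x x0.
  rewrite (@Rintegral_itvB _ f _ (BRight x) (0 : R)) ?bnd_simp ?lerN10//.
  rewrite Rintegral_itv_obnd_cbnd//.
  by apply: integrableS (If 0 x) => //; exact: subset_itv_oc_cc.
Qed.

(** Since [d - 2 >= 1] and sine lies in [0, 1] on [0, pi], the integrand is at most sine, the
    derivative of [- cos]. At [a = acos t] the bound becomes linear in [t], although [acos] is not
    Lipschitz near 1. *)
Lemma sin_integral_ge0_le_cos d a b : (3 <= d)%N -> 0 <= a -> a <= b ->
  b <= pi -> 0 <= sin_integral d b - sin_integral d a <= cos a - cos b.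
Proof.
move=> d3 a0; rewrite le_eqVlt => /predU1P[->|ab bpi].
  by rewrite !subrr lexx.
have [G [dG GE]] := sin_integral_primitive d.
rewrite !GE//; last exact: le_trans (ltW ab).
have -> : G b - G 0 - (G a - G 0) = G b - G a by ring.
have in0pi x : a <= x <= b -> 0 <= x <= pi.
  by move=> /andP[ax xb]; rewrite (le_trans a0 ax) (le_trans xb bpi).
have sin_ge0 c : a < c < b -> 0 <= sin c.
  by move=> /andP[/ltW ac /ltW cb]; rewrite sin_ge0_pi// in0pi// ac.
apply/andP; split.
  have [|c cab ->] := is_derive_MVT G (fun x => sin x ^+ (d - 2)) a b ab.
    by move=> x /in0pi; exact: dG.
  by rewrite mulr_ge0 ?exprn_ge0 ?sin_ge0// subr_ge0 ltW.
have [|c cab] := is_derive_MVT (fun x => - cos x - G x)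
    (fun x => sin x - sin x ^+ (d - 2)) a b ab.
  move=> x /in0pi xP; have := dG x xP => dGx.
  by apply: is_derive_eq; rewrite opprK.
move=> E; suff : 0 <= - cos b - G b - (- cos a - G a) by lra.
rewrite E mulr_ge0//; last by rewrite subr_ge0 ltW.
rewrite subr_ge0 -[leRHS]expr1 ler_wiXn2l ?sin_ge0 ?sin_le1//.
by rewrite subn_gt0.
Qed.

Lemma sin_integral_pi_gt0 d : 0 < sin_integral d pi :> R.
Proof.
have [G [dG GE]] := sin_integral_primitive d.
rewrite GE ?pi_ge0//.
have [c /sin_gt0_pi s0 ->] := is_derive_MVT _ _ _ _ (pi_gt0 R) dG.
by rewrite mulr_gt0 ?exprn_gt0// subr0 pi_gt0.
Qed.

Lemma sin_integral_pihalf d :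
  sin_integral d (pi / 2) = sin_integral d pi / 2 :> R.
Proof.
have [G [dG GE]] := sin_integral_primitive d.
have p0 := pi_gt0 R.
rewrite !GE; [|exact: ltW|by lra].
(* The reflection [x -> pi - x] preserves sine, so this sum is constant; its values at 0 and
   [pi / 2] give the claim. *)
have [||c _] := is_derive_MVT (fun x => G x + G (pi - x)) (fun=> 0) 0 (pi / 2).
- by lra.
- move=> x xP.
  have dGx : is_derive x 1 G (sin x ^+ (d - 2)) by apply: dG; lra.
  have dGpx : is_derive (pi - x) 1 G (sin (pi - x) ^+ (d - 2)).
    by apply: dG; lra.
  have dpx : is_derive x 1 (fun y : R => pi - y) (-1).
    by apply: is_derive_eq; rewrite add0r mul1r.
  have dcx := is_derive1_comp (g := fun y : R => pi - y) dGpx dpx.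
  have := is_deriveD dGx dcx => /is_derive_eq; apply.
  by rewrite sinB sinpi cospi mul0r sub0r mulN1r opprK mulrN1 subrr.
- have -> : pi - pi / 2 = pi / 2 :> R by field.
  by rewrite mul0r subr0 => E; lra.
Qed.

Lemma mu_CapN d t : 0 < t -> mu_Cap d (- t) = 1 - mu_Cap d t.
Proof.
move=> t0; rewrite /mu_Cap /mu_cap opprK oppr_ge0 lerN2 (leNgt t 0) t0 /=.
rewrite (ltW t0) andbC.
have -> : (- t <= 1) by lra.
have -> : (-1 <= t) by lra.
rewrite /=; have [//|t1] := leP t 1.
case: eqP => _; first by lra.
by case: ltP => [|_]; [lra|rewrite subr0].
Qed.

Lemma mu_Cap0 d : mu_Cap d 0 = 1 / 2 :> R.
Proof.
rewrite /mu_Cap /mu_cap lexx acos0 sin_integral_pihalf /Cd.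
rewrite lerN10 ler01 /=.
by field; rewrite gt_eqF// sin_integral_pi_gt0.
Qed.

(** On [0, 1] the constant is [Cd], by the cosine bound; beyond 1 the slope is -1/2 or 0. The pieces
    meet at the value 0, so an interval around 1 is cut there. *)
Lemma mu_Cap_bound_nneg d : (3 <= d)%N -> exists2 K : R, 0 < K &
  forall a b, 0 <= a -> a <= b ->
    0 <= mu_Cap d a - mu_Cap d b <= K * (b - a).
Proof.
move=> d3.
have C0 : 0 < Cd R d by rewrite invr_gt0 sin_integral_pi_gt0.
have mu1 : mu_Cap d 1 = 0 :> R.
  rewrite /mu_Cap /mu_cap lexx ler01 acos1 -subr_ge0 opprK addr_ge0//.
  by rewrite /sin_integral set_itv1 Rintegral_set1 mulr0.
have le1 a b : 0 <= a -> a <= b -> b <= 1 ->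
    0 <= mu_Cap d a - mu_Cap d b <= Cd R d * (b - a).
  move=> a0 ab b1; have b0 := le_trans a0 ab; have a1 := le_trans ab b1.
  rewrite /mu_Cap /mu_cap a0 b0 a1 b1.
  have -> : -1 <= a by lra.
  have -> : -1 <= b by lra.
  rewrite /= -mulrBr ler_pM2l// pmulr_rge0//.
  have aI : -1 <= a <= 1 by lra.
  have bI : -1 <= b <= 1 by lra.
  have le_acos : acos b <= acos a.
    rewrite leNgt; apply/negP => lt.
    have : cos (acos b) < cos (acos a).
      by rewrite ltr_cos ?in_itv /= ?acos_ge0 ?acos_lepi.
    by rewrite !acosK ?in_itv// ltNge ab.
  have := sin_integral_ge0_le_cos d (acos b) (acos a) d3 (acos_ge0 bI) le_acos
    (acos_lepi aI).
  by rewrite !acosK ?in_itv.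
have ge1 a b : 1 <= a -> a <= b ->
    0 <= mu_Cap d a - mu_Cap d b <= 1 * (b - a).
  have muE t : 1 <= t -> mu_Cap d t = if d == 3%N then - t / 2 + 1 / 2 else 0.
    rewrite le_eqVlt => /predU1P[<-|t1].
      by rewrite mu1; case: ifP => // _; lra.
    by rewrite /mu_Cap (leNgt t 1) t1 andbF.
  move=> a1 ab; rewrite !muE//; last exact: le_trans ab.
  by case: ifP => _; lra.
exists (Cd R d + 1); first by rewrite addr_gt0.
move=> a b a0 ab.
have Cba : 0 <= Cd R d * (b - a) by rewrite mulr_ge0 ?subr_ge0// ltW.
have [b1|/ltW b1] := leP b 1; first by have := le1 _ _ a0 ab b1; lra.
have [a1|/ltW a1] := leP 1 a; first by have := ge1 _ _ a1 ab; lra.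
have := le1 _ _ a0 a1 (lexx _); have := ge1 _ _ (lexx _) b1.
have : Cd R d * (1 - a) <= Cd R d * (b - a) by rewrite ler_pM2l// lerB.
by lra.
Qed.

(** The symmetry [mu_CapN], extended to 0 by [mu_Cap0], carries the bound to the negative half-line;
    an interval around 0 is cut at 0. *)
Lemma mu_Cap_bound d : (3 <= d)%N -> exists2 K : R, 0 < K &
  forall a b, a <= b -> 0 <= mu_Cap d a - mu_Cap d b <= K * (b - a).
Proof.
move=> /mu_Cap_bound_nneg[K K0 nneg].
have npos a b : a <= b -> b <= 0 ->
    0 <= mu_Cap d a - mu_Cap d b <= K * (b - a).
  have muN t : t <= 0 -> mu_Cap d t = 1 - mu_Cap d (- t).
    rewrite le_eqVlt => /predU1P[->|t0]; first by rewrite oppr0 mu_Cap0; lra.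
    have nt0 : 0 < - t by rewrite oppr_gt0.
    by have := mu_CapN d _ nt0; rewrite opprK.
  move=> ab b0; rewrite (muN b)// (muN a); last exact: le_trans b0.
  have := nneg (- b) (- a); rewrite oppr_ge0 lerN2 opprK => /(_ b0 ab).
  have -> : - a + b = b - a by ring.
  by lra.
exists K => // a b ab.
have [b0|/ltW b0] := leP b 0; first exact: npos.
have [a0|/ltW a0] := leP 0 a; first exact: nneg.
have := npos _ _ a0 (lexx _); have := nneg _ _ (lexx _) b0.
by rewrite subr0 sub0r mulrBr mulrN; lra.
Qed.

(** By monotonicity [s] may exceed [t] by any amount: only a lower bound on the new threshold will
    be known. *)
Lemma mu_Cap_le_lipschitz d : (3 <= d)%N -> exists2 K : R, 0 < K &
  forall s t e : R, 0 <= e -> t - e <= s -> mu_Cap d s <= mu_Cap d t + K * e.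
Proof.
move=> /mu_Cap_bound[K K0 KP]; exists K => // s t e e0 ts.
have : t - e <= t by lra.
move=> /KP; have := KP _ _ ts.
have -> : t - (t - e) = e by ring.
by lra.
Qed.

End CapMeasure.

(** * Dot products, Gram matrices and openness of genericity *)

Section Geometry.
Set Implicit Arguments.
Unset Strict Implicit.
Variables (R : realType) (d N : nat).
Implicit Types (X : 'M[R]_(d, N)) (I A : {set 'I_N}) (q u v w : 'cV[R]_d).

Lemma dotpE n (u v : 'cV[R]_n) : dotp u v = \sum_k u k 0 * v k 0.
Proof. by rewrite /dotp mxE; apply: eq_bigr => k _; rewrite !mxE. Qed.

Lemma dotpC n (u v : 'cV[R]_n) : dotp u v = dotp v u.
Proof. by rewrite !dotpE; apply: eq_bigr => k _; rewrite mulrC. Qed.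

Lemma dotpDl u v w : dotp (u + v) w = dotp u w + dotp v w.
Proof. by rewrite /dotp linearD mulmxDl mxE. Qed.

Lemma dotpZl c u w : dotp (c *: u) w = c * dotp u w.
Proof. by rewrite /dotp linearZ /= -scalemxAl mxE. Qed.

Lemma dotpNl u w : dotp (- u) w = - dotp u w.
Proof. by rewrite -scaleN1r dotpZl mulN1r. Qed.

Lemma dotpDr u v w : dotp w (u + v) = dotp w u + dotp w v.
Proof. by rewrite dotpC dotpDl !(dotpC w). Qed.

Lemma dotpZr c u w : dotp w (c *: u) = c * dotp w u.
Proof. by rewrite dotpC dotpZl dotpC. Qed.

Lemma dotp_ge0 n (u : 'cV[R]_n) : 0 <= dotp u u.
Proof. by rewrite dotpE sumr_ge0// => k _; rewrite -expr2 sqr_ge0. Qed.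

Lemma dotp_eq0 n (u : 'cV[R]_n) : (dotp u u == 0) = (u == 0).
Proof.
apply/eqP/eqP => [|->]; last by rewrite /dotp mulmx0 mxE.
rewrite dotpE => /psumr_eq0P u0; apply/matrixP => i j; rewrite ord1 mxE.
apply/eqP; rewrite -sqrf_eq0 expr2; apply/eqP/u0 => // k _.
by rewrite -expr2 sqr_ge0.
Qed.

(** A vector [c] killed by the Gram matrix satisfies [|subcols X I *m c|^2 = 0], so it is a linear
    relation between the points; the converse is immediate. *)
Lemma gram_unitmxP X I :
  reflect (free [seq col i X | i <- enum I]) (gram X I \in unitmx).
Proof.
have sumE (k : 'I_#|I| -> R) :
    \sum_i k i *: (map_tuple (fun i => col i X) (enum_tuple I))`_i =
    subcols X I *m \col_i k i.
  apply/matrixP => a b; rewrite ord1 summxE mxE; apply: eq_bigr => i _.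
  rewrite (nth_map (enum_val i)); last by rewrite size_tuple.
  by rewrite -enum_val_nth !mxE mulrC.
suff P : (gram X I \in unitmx) =
    free (map_tuple (fun i => col i X) (enum_tuple I)).
  by rewrite P; exact: idP.
apply/idP/freeP => [G k|inj].
  rewrite sumE => Xk i.
  have : gram X I *m (\col_i k i) = 0 by rewrite /gram -mulmxA Xk mulmx0.
  move=> /(congr1 (mulmx (invmx (gram X I)))); rewrite mulKmx// mulmx0.
  by move=> /matrixP/(_ i 0); rewrite !mxE.
rewrite -unitmx_tr -row_free_unit -kermx_eq0; apply/rowV0P => c /sub_kermxP cG.
have Xc : subcols X I *m c^T = 0.
  apply/eqP; rewrite -dotp_eq0 /dotp trmx_mul trmxK -mulmxA (mulmxA _^T).
  by rewrite -/(gram X I) -[gram X I]trmxK -trmx_mul cG trmx0 mulmx0 mxE.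
apply/rowP => i; rewrite mxE.
apply: (inj (fun i => c 0 i)); rewrite sumE -[RHS]Xc.
by congr mulmx; apply/matrixP => a b; rewrite !mxE ord1.
Qed.

Lemma generic_gram X I : generic X -> (#|I| <= d)%N -> gram X I \in unitmx.
Proof. by move=> gX Id; apply/gram_unitmxP/gX. Qed.

Lemma continuous_mul (T : topologicalType) (f g : T -> R) :
  continuous f -> continuous g -> continuous (fun x => f x * g x).
Proof. by move=> cf cg x; exact: continuousM (cf x) (cg x). Qed.

Lemma continuous_det (T : topologicalType) n (M : T -> 'M[R]_n) :
  (forall i j, continuous (fun x => M x i j)) ->
  continuous (fun x => \det (M x)).
Proof.
move=> cM; apply: continuous_big => [|s _]; first exact: add_continuous.
apply: continuous_mul; first exact: cst_continuous.
by apply: continuous_big => [|i _]; [exact: mul_continuous|exact: cM].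
Qed.

Lemma near_generic X : generic X -> \forall Y \near X, generic Y.
Proof.
move=> gX.
have : \forall Y \near X, forall I, (#|I| <= d)%N -> gram Y I \in unitmx.
  apply: (@filter_forall _ {set 'I_N}
    (fun I Y => (#|I| <= d)%N -> gram Y I \in unitmx) (nbhs X) _) => I.
  have [Id|_] := leqP #|I| d; last by near=> Y.
  have cdet : continuous (fun Y : 'M[R]_(d, N) => \det (gram Y I)).
    apply: continuous_det => i j.
    rewrite (_ : (fun Y => _) = fun Y : 'M[R]_(d, N) =>
        \sum_k Y k (enum_val i) * Y k (enum_val j)); last first.
      by apply/funext => Y; rewrite mxE; apply: eq_bigr => k _; rewrite !mxE.
    apply: continuous_big; first exact: add_continuous.
    by move=> k _; apply: continuous_mul; exact: coord_continuous.
  have := generic_gram gX Id; rewrite unitmxE unitfE => /(cvgr_neq0 _ (cdet X)).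
  by apply: filterS => Y; rewrite unitmxE unitfE.
by apply: filterS => Y gY I /gY /gram_unitmxP.
Unshelve. all: by end_near. Qed.

(* The least-norm solution y of <y, x_i> = 1 for i in I. *)
Definition dual_point X I : 'cV[R]_d :=
  subcols X I *m invmx (gram X I) *m ones R #|I|.

Lemma tr_subcols_mulE X I (w : 'cV[R]_d) k :
  ((subcols X I)^T *m w) k 0 = dotp w (col (enum_val k) X).
Proof.
by rewrite dotpE !mxE; apply: eq_bigr => j _; rewrite !mxE mulrC.
Qed.

Lemma dotp_dual_point X I i : gram X I \in unitmx -> i \in I ->
  dotp (dual_point X I) (col i X) = 1.
Proof.
move=> G iI; rewrite -(enum_rankK_in iI iI) -tr_subcols_mulE.
by rewrite /dual_point !mulmxA -/(gram X I) mulmxV// mul1mx mxE.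
Qed.

(** The right side is the quantity under the root in [tI]. With [y] the dual point, [tI] is
    therefore [1 / |y|] and [wI] is [y / |y|]. *)
Lemma dotp_dual_point_self X I : gram X I \in unitmx ->
  dotp (dual_point X I) (dual_point X I) =
  ((ones R #|I|)^T *m invmx (gram X I) *m ones R #|I|) ord0 ord0.
Proof.
move=> G; rewrite /dotp /dual_point !trmx_mul trmx_inv.
have -> : (gram X I)^T = gram X I by rewrite /gram trmx_mul trmxK.
rewrite -!mulmxA (mulmxA (subcols X I)^T) -/(gram X I).
by rewrite (mulmxA (gram X I)) mulmxV// mul1mx !mulmxA.
Qed.

Lemma dual_point_neq0 X I : gram X I \in unitmx -> (0 < #|I|)%N ->
  0 < dotp (dual_point X I) (dual_point X I).
Proof.
move=> G /card_gt0P[i iI]; rewrite lt_def dotp_ge0 andbT dotp_eq0.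
apply/eqP => y0; have := dotp_dual_point G iI.
by rewrite y0 /dotp trmx0 mul0mx mxE => /esym/eqP; rewrite oner_eq0.
Qed.

Lemma tIE X I : gram X I \in unitmx ->
  tI X I = (Num.sqrt (dotp (dual_point X I) (dual_point X I)))^-1.
Proof. by move=> G; rewrite dotp_dual_point_self. Qed.

Lemma tI_gt0 X I : gram X I \in unitmx -> (0 < #|I|)%N -> 0 < tI X I.
Proof.
by move=> G I0; rewrite tIE// invr_gt0 sqrtr_gt0 dual_point_neq0.
Qed.

Lemma dotp_wI X I i : gram X I \in unitmx -> i \in I ->
  dotp (wI X I) (col i X) = tI X I.
Proof. by move=> G iI; rewrite dotpZl dotp_dual_point// mulr1. Qed.

Lemma dotp_wI_self X I : gram X I \in unitmx -> (0 < #|I|)%N ->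
  dotp (wI X I) (wI X I) = 1.
Proof.
move=> G I0; have y0 := dual_point_neq0 G I0.
rewrite dotpZl dotpZr tIE// mulrA -expr2 exprVn sqr_sqrtr ?ltW//.
by rewrite mulVf// gt_eqF.
Qed.

(** Normalisation determines [t] up to sign, and the two signs give the two terms of
    [local_discrepancy]. *)
Lemma unit_dual_point X I t : gram X I \in unitmx -> (0 < #|I|)%N ->
    dotp (t *: dual_point X I) (t *: dual_point X I) = 1 ->
  (t *: dual_point X I = wI X I /\ t = tI X I) \/
  (t *: dual_point X I = - wI X I /\ t = - tI X I).
Proof.
move=> G I0; have := dotp_wI_self G I0; rewrite !dotpZl !dotpZr => <-.
have y0 := dual_point_neq0 G I0; rewrite !mulrA.
move=> /(mulIf (lt0r_neq0 y0))/eqP; rewrite -!expr2 eqf_sqr.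
by case/orP => /eqP ->; [left|right]; rewrite ?scaleNr.
Qed.


(** * Existence of a unit vector maximising the minimum over [A] *)

Lemma continuous_bigmin (T : topologicalType) (J : Type) (r : seq J)
    (P : pred J) (f0 : T -> R) (F : J -> T -> R) :
  continuous f0 -> (forall i, continuous (F i)) ->
  continuous (fun x => \big[Num.min/f0 x]_(i <- r | P i) F i x).
Proof.
move=> cf0 cF; elim: r => [|i r IH].
  by under eq_fun do rewrite big_nil.
under eq_fun do rewrite big_cons.
case: (P i) => //.
by move=> x; apply: continuous_min; [exact: cF|exact: IH].
Qed.

Lemma continuous_dotp (T : topologicalType) (f g : T -> 'cV[R]_d) :
  (forall k, continuous (fun x => f x k 0)) ->
  (forall k, continuous (fun x => g x k 0)) ->
  continuous (fun x => dotp (f x) (g x)).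
Proof.
move=> cf cg; under eq_fun do rewrite dotpE.
apply: continuous_big; first exact: add_continuous.
by move=> k _; exact: continuous_mul.
Qed.

Lemma unit_coord_le1 w k : dotp w w = 1 -> `|w k 0| <= 1.
Proof.
move=> w1; rewrite -(@expr_le1 _ 2)// real_normK ?num_real//.
rewrite -w1 dotpE (bigD1 k)//= -expr2 lerDl sumr_ge0// => j _.
by rewrite -expr2 sqr_ge0.
Qed.

Lemma max_min_dotp X A : (0 < d)%N -> (0 < #|A|)%N -> exists w t,
  [/\ dotp w w = 1,
      forall i, i \in A -> t <= dotp w (col i X) &
      forall v, dotp v v = 1 -> exists2 i, i \in A & dotp v (col i X) <= t].
Proof.
move=> d0 /card_gt0P[i0 i0A].
(* The unit sphere, in row vectors so that [rV_compact] applies to the cube containing it. *)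
pose S := [set v : 'rV[R]_d | dotp v^T v^T = 1]%classic.
have ctr k : continuous (fun v : 'rV[R]_d => v^T k 0).
  by under eq_fun do rewrite mxE; exact: coord_continuous.
have cdot : continuous (fun v : 'rV[R]_d => dotp v^T v^T).
  exact: continuous_dotp.
have S0 : (S !=set0)%classic.
  exists (delta_mx 0 (Ordinal d0)); rewrite /S /= dotpE.
  rewrite (bigD1 (Ordinal d0))//= !mxE !eqxx mulr1 big1 ?addr0// => k /negPf k0.
  by rewrite !mxE k0 andbF mul0r.
have cS : compact S.
  apply: (@subclosed_compact _ _
      [set v : 'rV[R]_d | forall i, `[(-1 : R), 1]%classic (v ord0 i)]%classic).
  - apply: (@closed_comp _ _ (fun v : 'rV[R]_d => dotp v^T v^T)
      [set 1]%classic).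
      by move=> v _; exact: cdot.
    exact: closed_eq.
  - exact: (@rV_compact _ _ (fun=> `[(-1 : R), 1]%classic)
      (fun=> @segment_compact _ _ _)).
  - move=> v /unit_coord_le1 v1 i /=.
    by rewrite in_itv /= -ler_norml; have := v1 i; rewrite mxE.
(* The default value of the minimum is the term of [i0], which belongs to [A], so it does not alter
   the minimum. *)
pose f (v : 'rV[R]_d) :=
  \big[Num.min/dotp v^T (col i0 X)]_(i in A) dotp v^T (col i X).
have cf : continuous f.
  have cdotc i : continuous (fun v : 'rV[R]_d => dotp v^T (col i X)).
    by apply: continuous_dotp => // k; exact: cst_continuous.
  exact: continuous_bigmin.
have [w wS wmax] := compact_EVT_max S0 cS (continuous_subspaceT cf).
exists w^T, (f w); split.
- exact: set_mem wS.
- by move=> i iA; exact: bigmin_le_cond.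
- move=> v v1; apply: contrapT => nle.
  have lt i : i \in A -> f w < dotp v (col i X).
    by move=> iA; rewrite ltNge; apply/negP => le; apply: nle; exists i.
  have : f v^T <= f w by apply: wmax; apply/mem_set; rewrite /S /= trmxK.
  apply/negP; rewrite -ltNge /f trmxK; apply/bigmin_gtP.
  by split=> [|i iA]; exact: lt.
Qed.

(** * First-order optimality of the maximiser *)

(** For [|w| = 1], [b = |y|^2] and [<w, y> = t * b], the root is [|w + e y|]. Its slope at 0 is
    [t * b], so the left side grows at rate [t ^+ 2 * b < 1]. The sign of [t] decides whether the
    root is bounded from below or from above. *)
Lemma near_mul_sqrt_lt (t b : R) : 0 <= b -> t ^+ 2 * b < 1 ->
  \forall e \near at_right (0 : R),
    t * Num.sqrt (1 + 2 * e * t * b + e ^+ 2 * b) < t + e.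
Proof.
move=> b0 tb; near=> e.
have e0 : 0 < e by near: e; exact: nbhs_right_gt.
(* This smallness of [e] absorbs the second-order term [t * e ^+ 2 * b / 2]; the summand 1 keeps the
   divisor positive. *)
have etb : e * (`|t| * b + 1) < 1 - t ^+ 2 * b.
  rewrite -ltr_pdivlMr ?ltr_wpDl ?mulr_ge0//.
  near: e; apply: nbhs_right_lt.
  by rewrite divr_gt0 ?subr_gt0// ltr_wpDl ?mulr_ge0.
set n2 := 1 + _ + _.
have d0 : 0 < e * (1 - t ^+ 2 * b) by rewrite mulr_gt0// subr_gt0.
have e2b : 0 <= e ^+ 2 * b by rewrite mulr_ge0// sqr_ge0.
have n20 : (1 + e * t * b) ^+ 2 <= n2.
  have : 0 <= e ^+ 2 * b * (1 - t ^+ 2 * b) by rewrite mulr_ge0// subr_ge0 ltW.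
  by rewrite /n2; nra.
have [t0|t0] := leP t 0.
- have s1 : 1 + e * t * b <= Num.sqrt n2.
    by apply: le_trans (ler_norm _) _; rewrite -sqrtr_sqr ler_wsqrtr.
  by have := ler_wnM2l t0 s1; nra.
- have tb0 : 0 <= e * t * b by rewrite !mulr_ge0// ltW.
  have s1 : Num.sqrt n2 <= 1 + e * t * b + e ^+ 2 * b / 2.
    rewrite -[leRHS]ger0_norm; last by lra.
    by rewrite -sqrtr_sqr ler_wsqrtr// /n2; nra.
  have := ler_wpM2l (ltW t0) s1; rewrite ger0_norm ?ltW// in etb.
  have : e * (e * (t * b + 1)) < e * (1 - t ^+ 2 * b) by rewrite ltr_pM2l.
  have : 0 <= t * (e ^+ 2 * b) by rewrite mulr_ge0// ltW.
  by nra.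
Unshelve. all: by end_near. Qed.

(** For the inactive constraints: strict at [e = 0], they remain so by continuity. *)
Lemma near_mul_sqrt_lt_slack (t b r z : R) : t < r ->
  \forall e \near at_right (0 : R),
    t * Num.sqrt (1 + 2 * e * t * b + e ^+ 2 * b) < r + e * z.
Proof.
move=> tr.
pose h (e : R) := r + e * z - t * Num.sqrt (1 + 2 * e * t * b + e ^+ 2 * b).
have ch : {for 0, continuous h}.
  apply: cvgB.
    apply: cvgD; first exact: cvg_cst.
    by apply: cvgM; [exact: cvg_id|exact: cvg_cst].
  apply: cvgM; first exact: cvg_cst.
  apply: continuous_comp; last exact: sqrt_continuous.
  apply: cvgD; last first.
    by apply: cvgM; [exact: (@exprn_continuous _ 2)|exact: cvg_cst].
  apply: cvgD; first exact: cvg_cst.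
  do 2 (apply: cvgM; last exact: cvg_cst).
  by apply: cvgM; [exact: cvg_cst|exact: cvg_id].
have h0 : 0 < h 0.
  by rewrite /h expr0n !(mul0r, mulr0, addr0) sqrtr1 mulr1 subr_gt0.
have hgt := cvgr_gt _ (cvg_at_right_filter ch) _ h0.
by near=> e; rewrite -subr_gt0; near: e; exact: hgt.
Unshelve. all: by end_near. Qed.

Lemma subset_card_minn A n :
  exists2 I : {set 'I_N}, I \subset A & #|I| = minn n #|A|.
Proof.
have /card_geqP[s [us sE sA]] : (minn n #|A| <= #|A|)%N by exact: geq_minr.
exists [set i in s]; first by apply/fintype.subsetP => i; rewrite inE => /sA.
by rewrite -sE cardsE; exact/card_uniqP.
Qed.

(** Here the points of [I] form a basis of the space, and [q] is orthogonal to all of them. *)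
Lemma tr_subcols_inj X I q : gram X I \in unitmx -> #|I| = d ->
  (subcols X I)^T *m q = 0 -> q = 0.
Proof.
move=> G Id Xq; suff fX : row_free (subcols X I).
  apply: trmx_inj; rewrite trmx0; apply/eqP; rewrite -(mulmx_free_eq0 _ fX).
  by rewrite -[X in _ *m X]trmxK -trmx_mul Xq trmx0.
rewrite /row_free eqn_leq rank_leq_row -{1}Id /=.
move: G; rewrite -row_full_unit /row_full => /eqP rG.
by apply: leq_trans (mxrankM_maxr (subcols X I)^T _); rewrite -/(gram X I) rG.
Qed.

(* Let B be the active constraints at the maximiser w and y the dual point of
   a subset I of B of size min(d, #B).  Then w - t y is orthogonal to the points
   of I.  If it were nonzero, then I = B, and moving w towards y would increase
   the normalised minimum at rate |w - t y|^2. *)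
Lemma optimal_halfspace X A w t : generic X -> dotp w w = 1 ->
    (forall i, i \in A -> t <= dotp w (col i X)) ->
    (forall v, dotp v v = 1 -> exists2 i, i \in A & dotp v (col i X) <= t) ->
  exists2 I : {set 'I_N}, I \in @Phi d N &
    (w = wI X I /\ t = tI X I) \/ (w = - wI X I /\ t = - tI X I).
Proof.
move=> gX w1 Aw wmax.
pose B := [set i in A | dotp w (col i X) == t].
have B0 : (0 < #|B|)%N.
  have [i iA le] := wmax w w1; apply/card_gt0P; exists i.
  by rewrite inE iA eq_le le Aw.
have d0 : (0 < d)%N.
  case: (posnP d) => // dE; move: w1; rewrite dotpE big1 => [/esym/eqP|k _].
    by rewrite oner_eq0.
  by case: k => k kd; exfalso; rewrite dE in kd.
have [I /fintype.subsetP IB IE] := subset_card_minn B d.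
have Id : (#|I| <= d)%N by rewrite IE geq_minl.
have I0 : (0 < #|I|)%N by rewrite IE leq_min d0.
have G := generic_gram gX Id.
exists I; first by rewrite inE I0.
have b0 := dual_point_neq0 G I0.
pose y := dual_point X I; pose b := dotp y y; pose q := w - t *: y.
have Iw i : i \in I -> dotp w (col i X) = t.
  by move=> /IB; rewrite inE => /andP[_ /eqP].
have Xq : (subcols X I)^T *m q = 0.
  apply/matrixP => k j; rewrite ord1 tr_subcols_mulE dotpDl dotpNl dotpZl.
  by rewrite dotp_dual_point ?Iw ?enum_valP// mulr1 subrr mxE.
(* [y] is a linear combination of the points of [I]. *)
have yq : dotp y q = 0.
  by rewrite /y /dual_point /dotp -mulmxA trmx_mul -mulmxA Xq mulmx0 mxE.
have yw : dotp w y = t * b.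
  have -> : w = t *: y + q by rewrite addrC subrK.
  by rewrite dotpDl dotpZl (dotpC q) yq addr0.
have qE : dotp q q = 1 - t ^+ 2 * b.
  rewrite {1}/q dotpDl dotpNl dotpZl yq mulr0 subr0 /q dotpDr -scaleNr dotpZr.
  by rewrite yw w1; ring.
have q0 : q = 0.
  apply/eqP/negPn/negP => qn0.
  have tb : t ^+ 2 * b < 1.
    by rewrite -subr_gt0 -qE lt_def dotp_ge0 dotp_eq0 qn0.
  have IBE : I = B.
    apply/eqP; rewrite eqEcard IE; apply/andP; split.
      exact/fintype.subsetP.
    (* With [d] or more active constraints, [I] has [d] elements, which forces [q = 0]. *)
    have [dB|//] := leqP d #|B|.
    case/negP: qn0; apply/eqP; apply: tr_subcols_inj Xq => //.
    by rewrite IE (minn_idPl dB).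
  (* This is [|w + e y|^2]; dividing [w + e y] by its root gives a unit vector that contradicts
     [wmax]. *)
  pose n2 (e : R) := 1 + 2 * e * t * b + e ^+ 2 * b.
  have : \forall e \near at_right (0 : R), forall i : 'I_N, i \in A ->
      t * Num.sqrt (n2 e) < dotp (w + e *: y) (col i X).
    apply: filter_forall => i.
    have [iA|_] := boolP (i \in A); last exact: nearW.
    have [ti|ti] := eqVneq (dotp w (col i X)) t.
      have iI : i \in I by rewrite IBE inE iA ti eqxx.
      have := near_mul_sqrt_lt (ltW b0) tb; apply: filterS => e lt _.
      by rewrite dotpDl dotpZl dotp_dual_point// ti mulr1.
    have lt : t < dotp w (col i X) by rewrite lt_def ti Aw.
    have := near_mul_sqrt_lt_slack b (dotp y (col i X)) lt.
    by apply: filterS => e {}lt _; rewrite dotpDl dotpZl.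
  move=> /(filterI (nbhs_right_gt (0 : R)))/filter_ex[e [e0 He]].
  pose v := w + e *: y.
  have vE : dotp v v = n2 e.
    rewrite /v !(dotpDl, dotpDr, dotpZl, dotpZr) w1 (dotpC y w) yw -/b /n2.
    by ring.
  have n0 : 0 < n2 e.
    have -> : n2 e = (1 + e * t * b) ^+ 2 + e ^+ 2 * b * (1 - t ^+ 2 * b).
      by rewrite /n2; ring.
    rewrite ltr_wpDl ?sqr_ge0// mulr_gt0 ?subr_gt0//.
    by rewrite mulr_gt0// exprn_gt0.
  have s0 : 0 < Num.sqrt (n2 e) by rewrite sqrtr_gt0.
  have [|i iA] := wmax ((Num.sqrt (n2 e))^-1 *: v).
    rewrite dotpZl dotpZr mulrA -expr2 vE exprVn sqr_sqrtr ?ltW//.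
    by rewrite mulVf// gt_eqF.
  rewrite dotpZl mulrC ler_pdivrMr//; apply/negP; rewrite -ltNge.
  exact: He.
have wE : w = t *: y by apply/eqP; rewrite -subr_eq0; apply/eqP.
by rewrite wE; apply: unit_dual_point => //; rewrite -wE.
Qed.

End Geometry.

(** * Comparison of [Lambda] at two generic point sets *)

Section Lipschitz.
Set Implicit Arguments.
Unset Strict Implicit.
Variables (R : realType) (d N : nat).
Implicit Types (X : 'M[R]_(d, N)) (I A : {set 'I_N}) (w : 'cV[R]_d).

(** Each of the [d] coordinates of [w] is at most 1 in modulus, and each entry of [X1 - X2] is at
    most its norm. *)
Lemma dotp_col_le X1 X2 w i : dotp w w = 1 ->
  dotp w (col i X1) <=
  dotp w (col i X2) + d%:R * euclidean_norm (X1 - X2).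
Proof.
move=> w1; rewrite -lerBlDl !dotpE -sumrB.
apply: (@le_trans _ _ (\sum_(k < d) euclidean_norm (X1 - X2))); last first.
  by rewrite sumr_const card_ord mulr_natl.
apply: ler_sum => k _; rewrite -mulrBr !mxE.
apply: le_trans (ler_norm _) _; rewrite normrM.
apply: (@le_trans _ _ (1 * `|X1 k i - X2 k i|)).
  by rewrite ler_wpM2r// unit_coord_le1.
rewrite mul1r -sqrtr_sqr ler_wsqrtr// (bigD1 k)//= (bigD1 i)//= !mxE -addrA.
rewrite lerDl addr_ge0// sumr_ge0// => j _; rewrite ?sqr_ge0//.
by rewrite sumr_ge0// => l _; rewrite sqr_ge0.
Qed.

(** Let [A] be the set of indices counted for [X1], and [(v, s)] optimal for [A] under [X2]. Testing
    with [w] gives [s >= t - E]; the new half-space still contains all points of [A]; and by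
    optimality [(v, s)] is one of the pairs occurring in [Lambda X2]. *)
Lemma mu_emp_le_Lambda (K : R) X1 X2 w t : (0 < d)%N -> (0 < N)%N ->
    (forall r s e : R, 0 <= e -> s - e <= r ->
      mu_Cap d r <= mu_Cap d s + K * e) ->
    generic X2 -> dotp w w = 1 -> (exists i, t <= dotp w (col i X1)) ->
  mu_emp X1 w t - mu_Cap d t <=
  Lambda X2 + K * (d%:R * euclidean_norm (X1 - X2)).
Proof.
move=> d0 N0 KP gX2 w1 [i0 i0P]; set E := d%:R * _.
have E0 : 0 <= E by rewrite mulr_ge0// sqrtr_ge0.
pose A := [set i | t <= dotp w (col i X1)].
have A0 : (0 < #|A|)%N by apply/card_gt0P; exists i0; rewrite inE.
have [v [s [v1 Av vmax]]] := max_min_dotp X2 d0 A0.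
have ts : t - E <= s.
  have [i iA le] := vmax w w1; rewrite lerBlDr.
  apply: le_trans (lerD le (lexx E)).
  by move: iA; rewrite inE => /le_trans; apply; exact: dotp_col_le.
have := KP _ _ _ E0 ts.
have : mu_emp X1 w t <= mu_emp X2 v s.
  rewrite ler_wpM2r// ler_nat; apply: subset_leq_card.
  by apply/fintype.subsetP => i iP; rewrite inE; apply: Av; rewrite inE.
have [I IP wIP] := optimal_halfspace gX2 v1 Av vmax.
have : mu_emp X2 v s - mu_Cap d s <= Lambda X2.
  apply: le_trans ((Lambda_max X2 d0 N0).2 I IP).
  rewrite /local_discrepancy le_max.
  by case: wIP => [[-> ->]|[-> ->]]; rewrite lexx ?orbT.
by lra.
Qed.

Lemma Lambda_le (K : R) X1 X2 : (0 < d)%N -> (0 < N)%N ->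
    (forall r s e : R, 0 <= e -> s - e <= r ->
      mu_Cap d r <= mu_Cap d s + K * e) ->
    generic X1 -> generic X2 ->
  Lambda X1 <= Lambda X2 + K * (d%:R * euclidean_norm (X1 - X2)).
Proof.
move=> d0 N0 KP gX1 gX2; have [[I IP ->] _] := Lambda_max X1 d0 N0.
have /andP[I0 Id] : (0 < #|I| <= d)%N by move: IP; rewrite inE.
have G := generic_gram gX1 Id; have [i iI] := card_gt0P I0.
(* Both half-spaces have the points of [I] on their boundary, so neither is empty. *)
rewrite ge_max !mu_emp_le_Lambda//.
- by rewrite dotpNl dotpC dotpNl opprK dotp_wI_self.
- by exists i; rewrite dotpNl dotp_wI.
- exact: dotp_wI_self.
- by exists i; rewrite dotp_wI.
Qed.

End Lipschitz.

Theorem theorem3 (R : realType) (d N : nat) (hd : (3 <= d)%N) (hN : (1 <= N)%N)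
    (Xbar : 'M[R]_(d, N)) (hX : generic Xbar) :
  exists U : set 'M[R]_(d, N),
    [/\ nbhs Xbar U,
        (forall X : 'M[R]_(d, N), U X -> generic X) &
        exists2 L : R, 0 < L &
          forall X1 X2 : 'M[R]_(d, N), U X1 -> U X2 ->
            `|Lambda X1 - Lambda X2| <= L * euclidean_norm (X1 - X2)].
Proof.
have d0 : (0 < d)%N by exact: ltn_trans hd.
(* The neighbourhood is the set of all generic point sets, and the constant [K * d] depends on [d]
   only. *)
exists (@generic R d N); split => //; first exact: near_generic.
have [K K0 KP] := mu_Cap_le_lipschitz R d hd.
exists (K * d%:R); first by rewrite mulr_gt0// ltr0n.
move=> X1 X2 gX1 gX2; rewrite -mulrA ler_norml lerBlDl lerBrDl.
have normC : euclidean_norm (X1 - X2) = euclidean_norm (X2 - X1).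
  congr Num.sqrt; apply: eq_bigr => i _; apply: eq_bigr => j _.
  by rewrite !mxE -opprB sqrrN.
rewrite (Lambda_le d0 hN KP)// andbT lerBlDr normC.
exact: Lambda_le d0 hN KP gX2 gX1.
Qed.
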